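(* Let $n > 51$ be an integer such that none of $n$, $n-1$, $n-2$, $n/2$, $(n-1)/2$, $(n-2)/2$ is a prime number. Let $\alpha, \beta \in A_n$ have prime orders $p$ and $q$ respectively, where $p \leq q$, and let $\alpha = \alpha_1 \cdots \alpha_m$ and $\beta = \beta_1 \cdots \beta_{m'}$ be their factorizations into disjoint (nontrivial) cycles. If $m' = 3$, $n - |S(\beta)| < 3$ and $n - |S(\alpha)| < 3$, then $d(\alpha,\beta) \leq 10$. Otherwise (that is, if at least one of these three conditions fails), $d(\alpha,\beta) \leq 8$. Here $d$ denotes the distance in $\mathcal{P}^*(A_n)$.
   Context: $A_n$ is the alternating group on $\{1,\dots,n\}$. For $\alpha \in A_n$, the support is $S(\alpha) = \{i \in \{1,\dots,n\} : \alpha(i) \neq i\}$. For a finite group $G$, the power graph $\mathcal{P}(G)$ is the simple undirected graph with vertex set $G$ in which two distinct elements $x \neq y$ are adjacent if and only if $y = x^m$ or $x = y^m$ for some positive integer $m$. The proper power graph $\mathcal{P}^*(G)$ is the graph obtained from $\mathcal{P}(G)$ by deleting the vertex $1$ (the identity element). The distance $d(x,y)$ is the length (number of edges) of a shortest path joining $x$ and $y$ in $\mathcal{P}^*(A_n)$. Since $\alpha$ has prime order $p$, each cycle $\alpha_i$ is a $p$-cycle; likewise each $\beta_j$ is a $q$-cycle. *)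

(* Defs.v *)
From mathcomp Require Import all_boot all_fingroup all_solvable.

Set Implicit Arguments.
Unset Strict Implicit.
Unset Printing Implicit Defensive.

Local Open Scope group_scope.

(* m / d is an integer and a prime number; no rounding is involved. *)
Definition prime_quotient (m d : nat) : bool := (d %| m) && prime (m %/ d).

Section PowerGraph.

Variable gT : finGroupType.
Implicit Types (G : {group gT}) (x y : gT).

(* The exponents 1, ..., #[x] give all the positive powers of x, which makes
   the relation boolean: see pos_powerP. *)
Definition pos_power x y : bool := [exists m : 'I_#[x], y == x ^+ m.+1].

Lemma pos_powerP x y :
  reflect (exists2 m : nat, 0 < m & y = x ^+ m) (pos_power x y).
Proof.
apply: (iffP existsP) => [[m /eqP->]|[[//|m] _ ->]]; first by exists m.+1.
exists (Ordinal (ltn_pmod m (order_gt0 x))).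
by rewrite /= !expgS expg_mod_order.
Qed.

Definition power_graph G : rel gT := fun x y =>
  [&& x \in G, y \in G, x != y & pos_power x y || pos_power y x].

Definition proper_power_graph G : rel gT := fun x y =>
  [&& x != 1, y != 1 & power_graph G x y].

End PowerGraph.

Section Distance.

Variables (T : eqType) (e : rel T).

(* The walk x :: s has size s edges. *)
Definition walk_between (x y : T) (s : seq T) : bool :=
  path e x s && (last x s == y).

Definition is_distance (x y : T) (d : nat) : Prop :=
  (exists2 s, walk_between x y s & size s = d) /\
  (forall s, walk_between x y s -> d <= size s).

(* In particular, some walk joins x to y. *)
Definition distance_le (x y : T) (k : nat) : Prop :=
  exists2 d, is_distance x y d & d <= k.

End Distance.

Section Cycles.

Variable T : finType.
Implicit Types (s c : {perm T}) (cs : seq {perm T}).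

Definition perm_support s : {set T} := [set i | s i != i].

(* c is the cycle (x_1 x_2 ... x_k), k > 1, with r = [:: x_1; ...; x_k];
   note that next r x = x when x does not occur in r. *)
Definition is_cycle c : Prop :=
  exists r : seq T, [/\ 1 < size r, uniq r & forall x, c x = next r x].

Definition cycle_factorization s cs : Prop :=
  [/\ s = \prod_(c <- cs) c,
      forall c, c \in cs -> is_cycle c &
      pairwise (fun c1 c2 => [disjoint perm_support c1 & perm_support c2]) cs].

End Cycles.

(* Main.v *)
(* Commuting elements x, y of coprime orders are joined by the path x, xy, y, so
   it suffices to link alpha to beta by four (resp. five) such steps. If s has
   prime order, k of its cycles (or k of its fixed points) can be permuted
   cyclically by a permutation commuting with s; this is even for k odd, and its
   square is an even involution for k = 4. The arithmetic hypotheses say that a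
   permutation of prime order moving at least n - 2 points has at least three
   cycles, so that alpha and beta each commute with an element of order 3 (unless
   they have order 3 themselves). An element of order 3 commutes with an
   involution moving at most 12 points, and with an element of order 5 fixing any
   12 given points: this gives the five steps
     alpha - order 3 - order 2 - order 5 - order 3 - beta.
   When one of the elements of order 3 moves at most 6 points, or both can be
   chosen to fix four common points, a single involution links them, saving a
   step. *)
Require Import Defs.
From mathcomp Require Import all_boot all_fingroup all_solvable.
From mathcomp Require Import zify.

Set Implicit Arguments.
Unset Strict Implicit.
Unset Printing Implicit Defensive.

Local Open Scope group_scope.

(** * Walks of bounded length and the distance *)

Section Walks.

Variables (T : eqType) (e : rel T).

Definition joined (k : nat) (x y : T) :=
  exists2 s, walk_between e x y s & size s <= k.

Lemma joined_trans k l y x z :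
  joined k x y -> joined l y z -> joined (k + l) x z.
Proof.
case=> s /andP[es /eqP ls] sk [t /andP[et /eqP lt] tl].
exists (s ++ t); last by rewrite size_cat leq_add.
by rewrite /walk_between cat_path last_cat ls es et lt /=.
Qed.

Lemma joined_leq k l x y : k <= l -> joined k x y -> joined l x y.
Proof. by move=> kl [s w sk]; exists s => //; apply: leq_trans kl. Qed.

Lemma joined_sym k x y : symmetric e -> joined k x y -> joined k y x.
Proof.
move=> sym_e [s /andP[es /eqP ls] sk]; exists (rev (belast x s)).
  rewrite /walk_between -ls rev_path (eq_path (e' := e)) ?es /=; last first.
    by move=> u v; apply: sym_e.
  by case: s {es ls sk} => //= z s; rewrite rev_cons last_rcons.
by rewrite size_rev size_belast.
Qed.

End Walks.

Lemma distance_le_joined (T : finType) (e : rel T) k x y :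
  joined e k x y -> distance_le e x y k.
Proof.
case=> s ws sk.
(* Ranging over tuples of a fixed length makes [P d] boolean, so that a least length can be
   extracted. *)
pose P d := [exists t : d.-tuple T, walk_between e x y t].
have exP : exists d, P d by exists (size s); apply/existsP; exists (in_tuple s).
case: (ex_minnP exP) => d /existsP[t wt] dmin.
have min_d s' : walk_between e x y s' -> d <= size s'.
  by move=> ws'; apply: dmin; apply/existsP; exists (in_tuple s').
exists d; last by apply: leq_trans sk; apply: min_d.
by split=> //; exists t; rewrite ?size_tuple.
Qed.

(** * Commuting elements of coprime orders *)

Section Commuting.

Variables (gT : finGroupType) (G : {group gT}).

Lemma joined_commute (x y : gT) : x \in G -> y \in G -> x != 1 -> y != 1 ->
  commute x y -> coprime #[x] #[y] -> joined (proper_power_graph G) 2 x y.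
Proof.
have pow (u v : gT) : u != 1 -> commute u v -> coprime #[u] #[v] ->
    pos_power (u * v) u.
  move=> u1 cuv co; apply/pos_powerP.
  (* This exponent is 1 modulo [#[u]] and 0 modulo [#[v]], so [(u * v) ^+ m] keeps [u] and kills
     [v]. *)
  set m := chinese #[u] #[v] 1 0.
  have m1 : m = 1 %[mod #[u]] by apply: chinese_modl.
  have m0 : m = 0 %[mod #[v]] by apply: chinese_modr.
  exists m; last first.
    rewrite expgMn // -(expg_mod_order u) m1 expg_mod_order expg1.
    by rewrite -(expg_mod_order v) m0 expg_mod_order expg0 mulg1.
  rewrite lt0n; apply: contraNneq u1 => m_0; rewrite m_0 in m1.
  by rewrite -[u]expg1 -expg_mod_order -m1 expg_mod_order.
move=> xG yG x1 y1 cxy co.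
have pxy := pow x y x1 cxy co.
have pyx : pos_power (x * y) y.
  by rewrite cxy; apply: pow; rewrite // coprime_sym.
have xy1 : x * y != 1.
  apply: contraNneq x1 => xy1; case/pos_powerP: pxy => m _ ->.
  by rewrite xy1 expg1n.
exists [:: x * y; y] => //.
rewrite /walk_between /= eqxx !andbT /proper_power_graph /power_graph.
rewrite x1 y1 xy1 xG yG groupM //= pxy pyx orbT !andbT.
by rewrite -{1}[x]mulg1 -{3}[y]mul1g (inj_eq (mulgI x)) (inj_eq (mulIg y)) eq_sym y1.
Qed.

End Commuting.

(** * Cyclic shifts of orbits of equal length *)

Section Orbits.

Variable T : finType.
Implicit Types (s g : {perm T}) (E X : {set T}).

Notation supp := (@perm_support T).

Lemma porbit_supp s x y : y \in porbit s x -> (y \in supp s) = (x \in supp s).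
Proof.
case/porbitP=> i ->; rewrite !inE.
have -> : s ((s ^+ i) x) = (s ^+ i) (s x) by rewrite -!permM -expgS -expgSr.
by rewrite (inj_eq perm_inj).
Qed.

Lemma disjoint_commute s g : [disjoint supp s & supp g] -> commute s g.
Proof.
apply: perm_onC; apply/subsetP => x; by rewrite !inE.
Qed.

Lemma card_porbit_prime s p x : prime p -> #[s] = p -> x \in supp s ->
  #|porbit s x| = p.
Proof.
move=> pp os; rewrite inE => sx.
have := dvdn_orbit 'P <[s]> x; rewrite -[#|<[s]>|]/#[s] os.
have -> : orbit 'P <[s]> x = porbit s x by rewrite porbit.unlock.
case/primeP: pp => _ /[apply] /orP[|/eqP//] /cards1P[y oy].
have /set1P e1 : x \in [set y] by rewrite -oy porbit_id.
have /set1P e2 : s x \in [set y] by rewrite -oy -{1}[s]expg1 mem_porbit.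
by rewrite e2 -e1 eqxx in sx.
Qed.

Lemma porbit_fix s x : x \notin supp s -> porbit s x = [set x].
Proof.
rewrite inE negbK => /eqP sx; apply/setP=> y; rewrite inE.
apply/porbitP/eqP=> [[i ->]|->]; last by exists 0; rewrite perm1.
by elim: i => [|i IH]; rewrite ?perm1 // expgSr permM IH.
Qed.

(** Greedy choice: [k.-1] orbits cover only [d * k.-1] points, so some point of [E] still lies in a
    new orbit. *)
Lemma orbit_select s E d k :
  (forall x, x \in E -> porbit s x \subset E) ->
  (forall x, x \in E -> #|porbit s x| = d) ->
  d * k.-1 < #|E| ->
  exists r : seq T, [/\ size r = k, uniq (map (porbit s) r),
    {subset r <= E} & #|\bigcup_(x <- r) porbit s x| = d * k]%N.
Proof.
move=> sE dE; elim: k => [|k IH] ltE.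
  by exists [::]; rewrite big_nil cards0 muln0.
have [|r [szr ur rE cr]] := IH.
  by apply: leq_ltn_trans ltE; rewrite leq_mul2l leq_pred orbT.
set U := \bigcup_(x <- r) porbit s x in cr.
have /subsetPn[x xE xU] : ~~ (E \subset U).
  by apply: contraL ltE => /subset_leq_card; rewrite cr -leqNgt.
have memU y z : y \in r -> z \in porbit s y -> z \in U.
  by move=> yr zy; rewrite /U bigcup_seq; apply/bigcupP; exists y.
exists (x :: r); split=> /=; rewrite ?szr //.
- rewrite ur andbT; apply/mapP=> -[y yr exy].
  by rewrite (memU y) // -exy porbit_id in xU.
- by move=> y /predU1P[->|/rE].
rewrite big_cons cardsU cr dE // (_ : _ :&: _ = set0) ?cards0 ?subn0 ?mulnS //.
apply/setP=> z; rewrite inE in_set0; apply/negP=> /andP[zx].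
rewrite /U bigcup_seq => /bigcupP[y yr zy].
case/negP: xU; apply: (memU y) => //.
by rewrite -eq_porbit_mem; move: zx zy; rewrite -!eq_porbit_mem => /eqP<- /eqP<-.
Qed.

Lemma expg_mod_porbit s x i : (s ^+ (i %% #|porbit s x|)) x = (s ^+ i) x.
Proof.
rewrite [in RHS](divn_eq i #|porbit s x|) expgD permM mulnC expgM.
by rewrite [X in _ = _ X]permX iter_fix // permX iter_porbit.
Qed.

Section Shift.

Variables (s : {perm T}) (d : nat) (x0 : T) (r : seq T).
Hypothesis uniq_r : uniq (map (porbit s) r).
Hypothesis card_r : forall x, x \in r -> #|porbit s x| = d.

Let k := size r.
Let U := \bigcup_(x <- r) porbit s x.

Lemma porbit_nth_inj i j a b : a < k -> b < k ->
  (s ^+ i) (nth x0 r a) = (s ^+ j) (nth x0 r b) -> a = b.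
Proof.
move=> ak bk eq_ab; apply/eqP.
rewrite -(nth_uniq (porbit s x0) _ _ uniq_r) ?size_map //.
by rewrite !(nth_map x0) // -(porbit_perm s i) eq_ab porbit_perm.
Qed.

Lemma mem_shift_supportP z :
  reflect (exists2 ij, ij.2 < k & z = (s ^+ ij.1) (nth x0 r ij.2)) (z \in U).
Proof.
rewrite /U bigcup_seq; apply: (iffP bigcupP) => [[x xr /porbitP[i ->]]|].
  by exists (i, index x r); rewrite /= ?index_mem ?nth_index.
by case=> -[i j] /= jk ->; exists (nth x0 r j); rewrite ?mem_nth ?mem_porbit.
Qed.

(** With [r_j] the chosen orbit representatives, [s^i r_j] is sent to [s^i r_(j+1)], indices modulo
    [k]: [find] recovers [j] and [index] recovers [i] modulo [d]. Keeping the exponent [i] is what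
    makes the map commute with [s]. *)
Definition shift_fun z :=
  let j := find (fun x => z \in porbit s x) r in
  if j < k then (s ^+ index z (traject s (nth x0 r j) d)) (nth x0 r (j.+1 %% k))
  else z.

Lemma shift_funE i j : j < k ->
  shift_fun ((s ^+ i) (nth x0 r j)) = (s ^+ i) (nth x0 r (j.+1 %% k)).
Proof.
move=> jk; rewrite /shift_fun; set z := (s ^+ i) _.
set P := fun x => _.
have hasP : has P r.
  by apply/hasP; exists (nth x0 r j); rewrite ?mem_nth // /P mem_porbit.
(* Distinct representatives lie in distinct orbits, so the search can only stop at [j]. *)
have -> : find P r = j.
  have fk : find P r < k by rewrite -has_find.
  have /(nth_find x0)/porbitP[l] := hasP.
  by move/esym/porbit_nth_inj; apply.
rewrite jk; have rd l : l < k -> #|porbit s (nth x0 r l)| = d.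
  by move=> lk; rewrite card_r ?mem_nth.
have j'k : j.+1 %% k < k by rewrite ltn_mod; apply: leq_trans jk.
(* The trajectory lists the [d] distinct points of the orbit. Reducing [i] modulo [d] is harmless at
   the target, whose orbit also has length [d]. *)
have -> : index z (traject s (nth x0 r j) d) = i %% d.
  rewrite /z -expg_mod_porbit rd // permX.
  have id : i %% d < d by rewrite ltn_mod -(rd j jk) lt0n card_porbit_neq0.
  rewrite -(nth_traject s id) index_uniq ?size_traject //.
  by rewrite -(rd j jk) uniq_traject_porbit.
by rewrite -[in LHS](rd _ j'k) expg_mod_porbit.
Qed.

Lemma shift_fun_out z : z \notin U -> shift_fun z = z.
Proof.
move=> zU; rewrite /shift_fun -has_find; case: hasP => // -[x xr zx].
by case/negP: zU; rewrite /U bigcup_seq; apply/bigcupP; exists x.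
Qed.

Lemma iter_shift_fun i j l : j < k ->
  iter l shift_fun ((s ^+ i) (nth x0 r j)) = (s ^+ i) (nth x0 r ((j + l) %% k)).
Proof.
move=> jk; elim: l => [|l IH] /=; first by rewrite addn0 modn_small.
have k0 : 0 < k by apply: leq_trans jk.
rewrite IH shift_funE ?ltn_mod //; congr (_ (nth _ _ _)).
by rewrite addnS -[in LHS]addn1 modnDml addn1.
Qed.

Lemma iter_shift_fun_size z : iter k shift_fun z = z.
Proof.
have [/mem_shift_supportP[[i j] /= jk ->]|/shift_fun_out zU] := boolP (z \in U).
  by rewrite iter_shift_fun // modnDr modn_small.
by elim: k => //= m ->.
Qed.

Lemma shift_fun_inj : injective shift_fun.
Proof.
case: (posnP k) => [k0 x y|k0].
  by rewrite /shift_fun k0.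
(* Since [k] shifts give the identity, [k.-1] shifts invert one. *)
apply: (can_inj (g := iter k.-1 shift_fun)) => z.
by rewrite -iterSr prednK // iter_shift_fun_size.
Qed.

Hypothesis k_gt1 : 1 < k.

Lemma porbit_shift : exists g, [/\ commute s g, g ^+ k = 1,
  forall l, 0 < l < k -> g ^+ l != 1 & supp g = U].
Proof.
pose g := perm shift_fun_inj.
have gX l z : (g ^+ l) z = iter l shift_fun z.
  by rewrite permX; apply: eq_iter => y; rewrite permE.
have k0 : 0 < k by apply: ltnW.
exists g; split.
- apply/permP=> z; rewrite !permM !permE.
  have [/mem_shift_supportP[[i j] /= jk ->]|zU] := boolP (z \in U).
    by rewrite shift_funE // -!permM -!expgSr shift_funE.
  rewrite !shift_fun_out //; apply: contra zU.
  case/mem_shift_supportP=> -[i j] /= jk szE.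
  rewrite /U bigcup_seq; apply/bigcupP; exists (nth x0 r j); rewrite ?mem_nth //.
  by rewrite -eq_porbit_mem -(porbit_perm s 1) expg1 szE porbit_perm.
- by apply/permP=> z; rewrite gX iter_shift_fun_size perm1.
(* The power [g ^+ l] sends representative 0 to representative [l]; if it were trivial, the two
   would coincide and [l] would be 0. *)
- move=> l /andP[l0 lk]; apply: contraTneq l0 => /permP/(_ (nth x0 r 0)).
  have := @iter_shift_fun 0 0 l k0; rewrite gX !expg0 !perm1 add0n modn_small //.
  move=> -> e0; have := @porbit_nth_inj 0 0 l 0 lk k0.
  by rewrite !expg0 !perm1 => /(_ e0)->.
apply/setP=> z; rewrite inE permE.
have [|/shift_fun_out->] := boolP (z \in U); last by rewrite eqxx.
case/mem_shift_supportP=> -[i j] /= jk ->.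
rewrite shift_funE //; apply/eqP=> /porbit_nth_inj.
rewrite ltn_mod => /(_ k0 jk).
have [j1k|] := ltnP j.+1 k; first by rewrite modn_small //; lia.
move=> kj; have -> : j.+1 = k by lia.
by rewrite modnn; lia.
Qed.

End Shift.

Lemma orbit_shift_in s E d k : 1 < k ->
  (forall x, x \in E -> porbit s x \subset E) ->
  (forall x, x \in E -> #|porbit s x| = d) ->
  d * k.-1 < #|E| ->
  exists g, [/\ commute s g, g ^+ k = 1, forall l, 0 < l < k -> g ^+ l != 1,
    supp g \subset E & #|supp g| = (d * k)%N].
Proof.
move=> k1 sE dE ltE.
have [r [szr ur rE cr]] := orbit_select sE dE ltE.
have x0 : T by case: r szr {ur rE cr} => [k0|x]; [rewrite -k0 in k1|].
have rd x : x \in r -> #|porbit s x| = d by move/rE/dE.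
have kr : 1 < size r by rewrite szr.
have [g [csg gk gl sg]] := porbit_shift x0 ur rd kr.
exists g; rewrite -szr sg; split=> //.
- by rewrite bigcup_seq; apply/bigcupsP => x /rE/sE.
by rewrite cr szr.
Qed.

Lemma odd_shift_in s E d k : prime k -> odd k ->
  (forall x, x \in E -> porbit s x \subset E) ->
  (forall x, x \in E -> #|porbit s x| = d) ->
  d * k.-1 < #|E| ->
  exists g, [/\ g \in 'Alt_T, commute s g, #[g] = k,
    supp g \subset E & #|supp g| = (d * k)%N].
Proof.
move=> pk ok sE dE ltE; have k1 := prime_gt1 pk.
have [g [csg gk gl sg cg]] := orbit_shift_in k1 sE dE ltE.
exists g; split=> //; last by apply: nt_prime_order => //; rewrite -[g]expg1 gl.
(* As [k] is odd and [g ^+ k = 1], [g] is the square of its power of exponent [(k + 1) / 2], hence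
   even. *)
have -> : g = g ^+ k./2.+1 * g ^+ k./2.+1.
  have kk : (k./2.+1 + k./2.+1 = k.+1)%N by lia.
  by rewrite -expgD kk expgS gk mulg1.
by rewrite Alt_even odd_permM addbb.
Qed.

(* The square of a cyclic shift of four orbits swaps two pairs of them. *)
Lemma involution_shift_in s E d :
  (forall x, x \in E -> porbit s x \subset E) ->
  (forall x, x \in E -> #|porbit s x| = d) ->
  d * 3 < #|E| ->
  exists g, [/\ g \in 'Alt_T, commute s g, #[g] = 2,
    supp g \subset E & #|supp g| <= d * 4].
Proof.
move=> sE dE ltE.
have [//|g [csg g4 gl sg cg]] := @orbit_shift_in s E d 4 _ sE dE ltE.
have sg2 : supp (g ^+ 2) \subset supp g.
  apply/subsetP=> x; rewrite !inE expgS expg1 permM.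
  by apply: contraNneq => gx; rewrite !gx.
exists (g ^+ 2); split.
- by rewrite Alt_even expgS expg1 odd_permM addbb.
- exact: commuteX.
- by apply: nt_prime_order; rewrite // -?expgM // gl.
- exact: subset_trans sg2 sg.
- by rewrite -cg subset_leq_card.
Qed.

End Orbits.

(** * Supports of products of disjoint cycles *)

Section Factorization.

Variable T : finType.
Implicit Types (s c : {perm T}) (cs : seq {perm T}).

Notation supp := (@perm_support T).

Lemma card_bigcup_leq (I : Type) (r : seq I) (P : pred I) (F : I -> {set T}) :
  #|\bigcup_(i <- r | P i) F i| <= \sum_(i <- r | P i) #|F i|.
Proof.
elim/big_rec2: _ => [|i m A _ IH]; first by rewrite cards0.
by apply: leq_trans (leq_card_setU _ _) _; rewrite leq_add2l.
Qed.

Lemma prod_fix cs x : {in cs, forall c, x \notin supp c} ->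
  (\prod_(c <- cs) c) x = x.
Proof.
elim: cs => [|c cs IH] xcs; first by rewrite big_nil perm1.
have := xcs c (mem_head _ _); rewrite inE negbK big_cons permM => /eqP->.
by apply: IH => d dcs; apply: xcs; rewrite inE dcs orbT.
Qed.

Lemma supp_closed s x : (s x \in supp s) = (x \in supp s).
Proof. by rewrite !inE (inj_eq perm_inj). Qed.

(** A point moved by one factor, and its image under that factor, are fixed by all the others. *)
Lemma prod_disjoint_supp cs :
  pairwise (fun c d => [disjoint supp c & supp d]) cs ->
  {in cs, forall c x, x \in supp c -> (\prod_(d <- cs) d) x = c x} /\
  #|supp (\prod_(c <- cs) c)| = \sum_(c <- cs) #|supp c|.
Proof.
elim: cs => [_|c cs IH /= /andP[/allP dc /IH[IH1 IH2]]].
  split=> //; rewrite !big_nil; apply/eqP; rewrite cards_eq0; apply/eqP/setP=> x.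
  by rewrite !inE perm1 eqxx.
set P := \prod_(d <- cs) d in IH1 IH2 *.
have Pc x : x \in supp c -> P x = x.
  by move=> xc; apply: prod_fix => d /dc/pred0P/(_ x) /=; rewrite xc => /= ->.
have cPE x : x \in supp c -> (c * P) x = c x.
  by move=> xc; rewrite permM Pc ?supp_closed.
rewrite big_cons -/P; split=> [d|].
  rewrite inE => /predU1P[-> //|dcs x xd]; rewrite permM.
  have := dc d dcs; rewrite disjoint_sym => /pred0P/(_ x) /=; rewrite xd /= inE.
  by move/negbFE/eqP->; apply: IH1.
rewrite big_cons -IH2 (_ : supp (c * P) = supp c :|: supp P).
  rewrite cardsU (_ : _ :&: _ = set0) ?cards0 ?subn0 //.
  apply/setP=> x; rewrite in_setI in_set0; apply/negP=> /andP[xc].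
  by rewrite inE Pc ?eqxx.
apply/setP=> x; rewrite in_setU.
have [xc|xc] /= := boolP (x \in supp c); first by rewrite inE cPE //; rewrite inE in xc.
by move: xc; rewrite !inE negbK permM => /eqP->.
Qed.

Lemma cycle_supp_porbit c : is_cycle c ->
  exists2 x, x \in supp c & supp c = porbit c x.
Proof.
case=> r [szr ur cE].
have cr : fcycle c r.
  by have := cycle_next ur; rewrite (@eq_cycle _ _ (frel c)) // => x y /=; rewrite cE.
case: r szr ur cE cr => [|a [|b r]] // _ ur cE cr.
have ac : a \in supp c.
  rewrite inE cE /= eqxx; apply: contraTneq ur => ->.
  by rewrite /= mem_head.
exists a => //; apply/setP=> y; apply/idP/idP; last by move/porbit_supp->.
rewrite inE cE next_nth; case: ifP => [yr _|_]; last by rewrite eqxx.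
have := fconnect_cycle cr (mem_head _ _) y; rewrite yr => cy.
by rewrite -(iter_findex cy) -permX mem_porbit.
Qed.

(** The support of each cycle is an orbit of [s] on moved points, which has [p] points because [p]
    is prime. *)
Lemma card_supp_factorization s cs p : prime p -> #[s] = p ->
  cycle_factorization s cs -> #|supp s| = (p * size cs)%N.
Proof.
move=> pp os [sP cyc_cs pw]; rewrite sP in os *.
have [sE ->] := prod_disjoint_supp pw.
rewrite -sum1_size big_distrr /= muln1 !big_seq; apply: eq_bigr => c ccs.
have [x xc sc] := cycle_supp_porbit (cyc_cs c ccs).
set t := \prod_(c <- cs) c in os sE.
have tX i : (t ^+ i) x = (c ^+ i) x.
  elim: i => [|i IH]; first by rewrite !expg0.
  by rewrite !expgSr !permM IH (sE c ccs) // sc mem_porbit.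
have -> : supp c = porbit t x.
  rewrite sc; apply/setP=> y.
  by apply/porbitP/porbitP=> -[i ->]; exists i; rewrite tX.
apply: card_porbit_prime => //.
by rewrite inE (sE c ccs) //; rewrite inE in xc.
Qed.

End Factorization.

(** * Commuting elements of orders 2, 3 and 5 *)

Section Neighbours.

Variable T : finType.
Hypothesis T_gt51 : 51 < #|T|.
Implicit Types (s g a b : {perm T}) (E X B : {set T}).

Notation supp := (@perm_support T).
Notation reach := (joined (proper_power_graph 'Alt_T)).
(** For [s] of prime order [p], this guarantees three fixed points or three [p]-cycles to permute.
    If [p = 2] and at most two points are fixed, the size of [T] already forces enough
    transpositions. *)
Notation shiftable s p :=
  ((p == 2) || (2 < #|~: supp s|) || (p * 2 < #|supp s|)).

Lemma moved_orbits s p : prime p -> #[s] = p ->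
  (forall x, x \in supp s -> porbit s x \subset supp s) /\
  (forall x, x \in supp s -> #|porbit s x| = p).
Proof.
move=> pp os; split=> x xs; last exact: card_porbit_prime.
by apply/subsetP=> y /porbit_supp->.
Qed.

Lemma fixed_orbits s E : [disjoint E & supp s] ->
  (forall x, x \in E -> porbit s x \subset E) /\
  (forall x, x \in E -> #|porbit s x| = 1%N).
Proof.
move=> dE; have fE x : x \in E -> porbit s x = [set x].
  by move=> xE; rewrite porbit_fix // (disjointFr dE).
by split=> x xE; rewrite fE ?sub1set ?cards1.
Qed.

(** Each moved point of [X] spoils at most one [p]-cycle, and each fixed point of [X] spoils only
    itself. The two alternatives leave more than [m] cycles ([d = p]) or more than [m] fixed points
    ([d = 1]) away from [X]. *)
Lemma orbits_avoiding s p X m : prime p -> #[s] = p ->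
  (p * (m + #|X :&: supp s|) < #|supp s|) || (m + #|X :\: supp s| < #|~: supp s|) ->
  exists E d, [/\ (forall x, x \in E -> porbit s x \subset E),
    (forall x, x \in E -> #|porbit s x| = d), d * m < #|E|,
    [disjoint E & X] & d <= p].
Proof.
move=> pp os /orP[ltm|ltm]; last first.
  have /fixed_orbits[stE cE] : [disjoint ~: supp s :\: X & supp s].
    by apply/pred0P=> x /=; rewrite !inE; case: (s x == x); rewrite ?andbF.
  exists (~: supp s :\: X), 1%N; split=> //; last exact: prime_gt0.
    rewrite mul1n cardsD; move: ltm; rewrite setDE setIC; lia.
  by apply/pred0P=> x /=; rewrite in_setD; case: (x \in X); rewrite ?andbF.
set Y := \bigcup_(x in X :&: supp s) porbit s x.
have [stS cS] := moved_orbits pp os.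
exists (supp s :\: Y), p; split=> //.
- move=> x /setDP[xs xY]; apply/subsetP=> y yx; rewrite in_setD (porbit_supp yx) xs.
  rewrite andbT; apply: contra xY => /bigcupP[z zX yz]; apply/bigcupP; exists z => //.
  by move: yx yz; rewrite -!eq_porbit_mem => /eqP->.
- by move=> x /setDP[/cS].
- have cY : #|Y| <= p * #|X :&: supp s|.
    apply: leq_trans (card_bigcup_leq _ _ _) _.
    rewrite (eq_bigr (fun _ => p)) ?sum_nat_const 1?mulnC // => x /setIP[_ /cS] //.
  have := subset_leq_card (subsetIr (supp s) Y); rewrite cardsD; lia.
apply/pred0P=> x /=; apply/negP=> /andP[/setDP[xs xY] xX].
by case/bigcupP: xY; exists x; rewrite ?porbit_id // inE xX xs.
Qed.

Lemma disjointS_sym E X g : supp g \subset E -> [disjoint E & X] ->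
  [disjoint X & supp g].
Proof. by move=> sE dEX; rewrite disjoint_sym; apply: disjointWl dEX. Qed.

Lemma involution_avoiding s X : #[s] = 3 -> #|X| <= 6 ->
  exists g, [/\ g \in 'Alt_T, commute s g, #[g] = 2, [disjoint X & supp g]
    & #|supp g| <= 12].
Proof.
move=> os X6.
have [|E [d [stE cE ltE dEX d3]]] := @orbits_avoiding s 3 X 3 isT os.
  (* If both alternatives failed, with [X] meeting the support in [u] points and its complement in
     [v], then [#|T| <= 3 * (3 + u) + (3 + v) <= 30]. *)
  have := cardsC (supp s); have := cardsID (supp s) X; lia.
have [g [gA csg og sg cg]] := involution_shift_in stE cE ltE.
exists g; split=> //; first exact: disjointS_sym dEX.
by lia.
Qed.

(* Elements with 16 three-cycles are excluded because, when #|T| = 52, twelve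
   points can leave only four of the cycles and the four fixed points untouched. *)
Lemma quintic_avoiding s X : #[s] = 3 -> (#|supp s| <= 45) || (51 <= #|supp s|) ->
  #|X| <= 12 ->
  exists g, [/\ g \in 'Alt_T, commute s g, #[g] = 5 & [disjoint X & supp g]].
Proof.
move=> os cs X12.
have [|E [d [stE cE ltE dEX d3]]] := @orbits_avoiding s 3 X 4 isT os.
  have := cardsC (supp s); have := cardsID (supp s) X; lia.
have [g [gA csg og sg cg]] := @odd_shift_in T s E d 5 isT isT stE cE ltE.
by exists g; split=> //; apply: disjointS_sym dEX.
Qed.

(** Three fixed points give a 3-cycle, three transpositions give 6 moved points. The bound 6 is the
    one [involution_avoiding] can tolerate. *)
Lemma cubic_small s p : prime p -> #[s] = p -> (p == 2) || (2 < #|~: supp s|) ->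
  exists g, [/\ g \in 'Alt_T, commute s g, #[g] = 3 & #|supp g| <= 6].
Proof.
move=> pp os; have [f3 _|f2] := ltnP 2 #|~: supp s|.
  have [|stE cE] := @fixed_orbits s (~: supp s).
    by rewrite disjoints_subset.
  have [|g [gA csg og _ cg]] := @odd_shift_in T s _ 1 3 isT isT stE cE.
    by rewrite mul1n.
  by exists g; rewrite cg.
rewrite orbF => /eqP p2; have [stE cE] := moved_orbits pp os.
have [|g [gA csg og _ cg]] := @odd_shift_in T s _ p 3 isT isT stE cE.
  have := cardsC (supp s); lia.
by exists g; rewrite cg p2.
Qed.

Lemma cubic_large s p : prime p -> #[s] = p -> p * 2 < #|supp s| ->
  exists g, [/\ g \in 'Alt_T, commute s g, #[g] = 3 & #|supp g| = (p * 3)%N].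
Proof.
move=> pp os lts; have [stE cE] := moved_orbits pp os.
have [g [gA csg og _ cg]] := @odd_shift_in T s _ p 3 isT isT stE cE lts.
by exists g.
Qed.

Lemma cubic_exists s p : prime p -> #[s] = p ->
  shiftable s p -> exists g, [/\ g \in 'Alt_T, commute s g, #[g] = 3
    & (#|supp g| <= 45) || (51 <= #|supp g|)].
Proof.
move=> pp os /orP[/(cubic_small pp os)|/(cubic_large pp os)].
  by case=> g [gA csg og cg]; exists g; split=> //; apply/orP; left; lia.
case=> g [gA csg og cg]; exists g; split=> //; rewrite cg.
(* The only multiple of 3 strictly between 45 and 51 is 48. *)
suff : p != 16 by lia.
by apply: contraTneq pp => ->.
Qed.

(* Shift three of four p-cycles; each point of [B] is outside of at least one
   of the four triples of cycles. *)
Lemma cubic_sparing s p B : prime p -> #[s] = p -> p * 3 < #|supp s| -> 12 < #|B| ->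
  exists g, [/\ g \in 'Alt_T, commute s g, #[g] = 3 & 3 < #|B :\: supp g|].
Proof.
move=> pp os lts B13; have [stS cS] := moved_orbits pp os.
have [r [szr ur rS cr]] := @orbit_select T s (supp s) p 4 stS cS lts.
set U := \bigcup_(x <- r) porbit s x in cr.
have memU x y : x \in r -> y \in porbit s x -> y \in U.
  by move=> xr yx; rewrite /U bigcup_seq; apply/bigcupP; exists x.
(* Pigeonhole: the four sets cover [B], so if each had at most 3 points, [B] would have at most
   12. *)
have [x xr ltx] : exists2 x, x \in r & 3 < #|B :\: (U :\: porbit s x)|.
  apply/hasP; apply: contraLR B13 => /hasPn hr; rewrite -leqNgt.
  have sB : B \subset \bigcup_(x <- r) (B :\: (U :\: porbit s x)).
    apply/subsetP=> b bB; rewrite bigcup_seq; apply/bigcupP.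
    have [|bU] := boolP (b \in U).
      rewrite {1}/U bigcup_seq => /bigcupP[x xr bx]; exists x => //.
      by rewrite !in_setD bB bx.
    case: (r) szr => // x r' _; exists x; first exact: mem_head.
    by rewrite !in_setD bB (negbTE bU) andbF.
  apply: leq_trans (subset_leq_card sB) _; apply: leq_trans (card_bigcup_leq _ _ _) _.
  have -> : 12 = \sum_(x <- r) 3 by rewrite big_const_seq count_predT szr.
  by rewrite !big_seq; apply: leq_sum => x /hr; rewrite -leqNgt.
have xS := rS x xr.
have sE y : y \in U :\: porbit s x -> y \in supp s.
  case/setDP; rewrite /U bigcup_seq => /bigcupP[z /rS zS yz _].
  by rewrite (porbit_supp yz).
have [|||g [gA csg og sg _]] := @odd_shift_in T s (U :\: porbit s x) p 3 isT isT.
- move=> y /setDP[yU yx]; apply/subsetP=> z zy; rewrite in_setD; apply/andP; split.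
    by apply: contra yx; move: zy; rewrite -!eq_porbit_mem => /eqP->.
  move: yU; rewrite /U !bigcup_seq => /bigcupP[w wr yw]; apply/bigcupP; exists w => //.
  by move: zy yw; rewrite -!eq_porbit_mem => /eqP->.
- by move=> y /sE/cS.
- have := prime_gt0 pp; have := subset_leq_card (subsetIr U (porbit s x)).
  rewrite cardsD cr (cS x xS) /=; lia.
exists g; split=> //; apply: leq_trans ltx _.
by rewrite subset_leq_card // setDS.
Qed.

Lemma reach_commute a b p q : a \in 'Alt_T -> b \in 'Alt_T -> #[a] = p -> #[b] = q ->
  prime p -> prime q -> p != q -> commute a b -> reach 2 a b.
Proof.
move=> aA bA oa ob pp pq npq cab.
apply: joined_commute => //; rewrite -?order_gt1 ?oa ?ob ?prime_gt1 //.
by rewrite prime_coprime // dvdn_prime2.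
Qed.

Lemma free_involution E : 3 < #|E| ->
  exists g, [/\ g \in 'Alt_T, #[g] = 2 & supp g \subset E].
Proof.
(* For the identity every orbit is a single point, so the shift construction yields an involution
   inside [E]. *)
move=> E4; have [|stE cE] := @fixed_orbits 1 E.
  by apply/pred0P=> x /=; rewrite !inE perm1 eqxx andbF.
have [|g [gA _ og sg _]] := involution_shift_in stE cE; first by rewrite mul1n.
by exists g.
Qed.

Lemma free_cubic E : 2 < #|E| ->
  exists g, [/\ g \in 'Alt_T, #[g] = 3 & supp g \subset E].
Proof.
move=> E3; have [|stE cE] := @fixed_orbits 1 E.
  by apply/pred0P=> x /=; rewrite !inE perm1 eqxx andbF.
have [|g [gA _ og sg _]] := @odd_shift_in T 1 E _ 3 isT isT stE cE.
  by rewrite mul1n.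
by exists g.
Qed.

(** * Walks between elements of prime order *)

Lemma reach_sym k a b : reach k a b -> reach k b a.
Proof.
apply: joined_sym => {a b} a b; rewrite /proper_power_graph /power_graph.
rewrite (eq_sym a b) (orbC (pos_power a b)).
by case: (a != 1); case: (b != 1); case: (a \in _); case: (b \in _).
Qed.

(** The orders along the way are 3, 2, 3, 2, 3: the two involutions move at most 24 points together,
    which leaves room for a 3-cycle disjoint from both. *)
Lemma reach_3_3 a b : a \in 'Alt_T -> b \in 'Alt_T -> #[a] = 3 -> #[b] = 3 ->
  reach 8 a b.
Proof.
move=> aA bA oa3 ob3.
have [|g [gA cag og _ sg]] := @involution_avoiding a set0 oa3.
  by rewrite cards0.
have [|h [hA cbh oh _ sh]] := @involution_avoiding b set0 ob3.
  by rewrite cards0.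
have [|c [cA oc sc]] := @free_cubic (~: (supp g :|: supp h)).
  have := cardsC (supp g :|: supp h).
  have [le_gh _] := leq_card_setU (supp g) (supp h); lia.
rewrite setCU subsetI -!disjoints_subset in sc; case/andP: sc => cg ch.
apply: (joined_trans (k := 2)).
  exact: (reach_commute aA gA oa3 og).
apply: (joined_trans (k := 2)).
  apply: (reach_commute gA cA og oc) => //.
  by apply: disjoint_commute; rewrite disjoint_sym.
apply: (joined_trans (k := 2)).
  by apply: (reach_commute cA hA oc oh) => //; apply: disjoint_commute.
by apply: (reach_commute hA bA oh ob3); rewrite // /commute cbh.
Qed.

(** Here [a] is itself the first element of order 3, which saves one of the five steps. *)
Lemma reach_3 a b q : a \in 'Alt_T -> b \in 'Alt_T -> #[a] = 3 ->
  prime q -> #[b] = q -> q != 3 -> shiftable b q -> reach 8 a b.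
Proof.
move=> aA bA oa3 q_prime order_b q3 b_cond.
have [|g [gA cag og _ sg]] := @involution_avoiding a set0 oa3.
  by rewrite cards0.
have [h [hA cbh oh ch]] := cubic_exists q_prime order_b b_cond.
have [c [cA chc oc dgc]] := quintic_avoiding oh ch sg.
apply: (joined_trans (k := 2)).
  exact: (reach_commute aA gA oa3 og).
apply: (joined_trans (k := 2)).
  by apply: (reach_commute gA cA og oc) => //; apply: disjoint_commute.
apply: (joined_trans (k := 2)).
  by apply: (reach_commute cA hA oc oh); rewrite // /commute chc.
by apply: (reach_commute hA bA oh order_b); rewrite // 1?eq_sym // /commute cbh.
Qed.

Section Pair.

Variables (a b : {perm T}) (p q : nat).
Hypotheses (aA : a \in 'Alt_T) (bA : b \in 'Alt_T).
Hypotheses (p_prime : prime p) (q_prime : prime q).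
Hypotheses (order_a : #[a] = p) (order_b : #[b] = q).
Hypotheses (p3 : p != 3) (q3 : q != 3).

Lemma reach_ten : shiftable a p -> shiftable b q -> reach 10 a b.
Proof.
move=> a_cond b_cond.
have [f [fA caf of_ _]] := cubic_exists p_prime order_a a_cond.
have [|g [gA cfg og _ sg]] := @involution_avoiding f set0 of_.
  by rewrite cards0.
have [h [hA cbh oh ch]] := cubic_exists q_prime order_b b_cond.
have [c [cA chc oc dgc]] := quintic_avoiding oh ch sg.
apply: (joined_trans (k := 2)).
  exact: (reach_commute aA fA order_a of_).
apply: (joined_trans (k := 2)).
  exact: (reach_commute fA gA of_ og).
apply: (joined_trans (k := 2)).
  by apply: (reach_commute gA cA og oc) => //; apply: disjoint_commute.
apply: (joined_trans (k := 2)).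
  by apply: (reach_commute cA hA oc oh); rewrite // /commute chc.
by apply: (reach_commute hA bA oh order_b); rewrite // 1?eq_sym // /commute cbh.
Qed.

(** The first element of order 3 moves at most 6 points, so an involution commuting with the second
    one can avoid them. *)
Lemma reach_small : (p == 2) || (2 < #|~: supp a|) -> shiftable b q ->
  reach 8 a b.
Proof.
move=> a_cond b_cond.
have [f [fA caf of_ cf]] := cubic_small p_prime order_a a_cond.
have [h [hA cbh oh _]] := cubic_exists q_prime order_b b_cond.
have [g [gA chg og dfg _]] := involution_avoiding oh cf.
apply: (joined_trans (k := 2)).
  exact: (reach_commute aA fA order_a of_).
apply: (joined_trans (k := 2)).
  by apply: (reach_commute fA gA of_ og) => //; apply: disjoint_commute.
apply: (joined_trans (k := 2)).
  by apply: (reach_commute gA hA og oh); rewrite // /commute chg.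
by apply: (reach_commute hA bA oh order_b); rewrite // 1?eq_sym // /commute cbh.
Qed.

(** With four cycles on each side, the elements of order 3 can be chosen to fix four common points;
    a double transposition of these commutes with both. *)
Lemma reach_large : p * 3 < #|supp a| -> q * 4 <= #|supp b| -> reach 8 a b.
Proof.
move=> a_large b_large.
have q0 := prime_gt0 q_prime.
have [|h [hA cbh oh ch]] := cubic_large q_prime order_b; first by lia.
(* From [4q <= #|T|] the complement has at least [#|T| / 4] points, which is at least 13 once
   [#|T| >= 52]. *)
have B13 : 12 < #|~: supp h|.
  have := cardsC (supp h); have := cardsC (supp b); lia.
have [f [fA caf of_ cf]] := cubic_sparing p_prime order_a a_large B13.
have [g [gA og]] := free_involution cf.
rewrite setDE setIC subsetI -!disjoints_subset => /andP[dgf dgh].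
apply: (joined_trans (k := 2)).
  exact: (reach_commute aA fA order_a of_).
apply: (joined_trans (k := 2)).
  apply: (reach_commute fA gA of_ og) => //.
  by apply: disjoint_commute; rewrite disjoint_sym.
apply: (joined_trans (k := 2)).
  by apply: (reach_commute gA hA og oh) => //; apply: disjoint_commute.
by apply: (reach_commute hA bA oh order_b); rewrite // 1?eq_sym // /commute cbh.
Qed.

End Pair.

(** With at most two fixed points, [p * m] is [#|T|], [#|T| - 1] or [#|T| - 2]. One cycle would make
    one of these numbers prime, and two cycles would make the half of one prime. *)
Lemma shiftable_card_supp s p m : prime p -> #|supp s| = (p * m)%N ->
  ~~ prime #|T| -> ~~ prime (#|T| - 1) -> ~~ prime (#|T| - 2) ->
  ~~ prime_quotient #|T| 2 -> ~~ prime_quotient (#|T| - 1) 2 ->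
  ~~ prime_quotient (#|T| - 2) 2 -> shiftable s p.
Proof.
move=> pp cs n0 n1 n2 h0 h1 h2.
have [_|f2] := ltnP 2 #|~: supp s|; first by rewrite orbT.
rewrite orbF; apply/orP; right; rewrite cs ltn_pmul2l ?prime_gt0 //.
have cT := cardsC (supp s); rewrite cs in cT.
have quot l : l = (p * 2)%N -> prime_quotient l 2.
  by move=> ->; rewrite /prime_quotient dvdn_mull // mulnK.
case: m {cs} cT => [|[|[|//]]] cT; first by lia.
  have [e|[e|e]] : p = #|T| \/ p = (#|T| - 1)%N \/ p = (#|T| - 2)%N by lia.
  - by rewrite -e pp in n0.
  - by rewrite -e pp in n1.
  - by rewrite -e pp in n2.
have [e|[e|e]] : #|T| = (p * 2)%N \/ (#|T| - 1 = p * 2)%N \/ (#|T| - 2 = p * 2)%N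
  by lia.
- by rewrite quot in h0.
- by rewrite quot in h1.
- by rewrite quot in h2.
Qed.

End Neighbours.

(** * The bounds 10 and 8 for the distance *)

Theorem lemma2p4 (n : nat) (n_gt51 : 51 < n)
    (n_not_prime : ~~ prime n)
    (n1_not_prime : ~~ prime (n - 1))
    (n2_not_prime : ~~ prime (n - 2))
    (half_n_not_prime : ~~ prime_quotient n 2)
    (half_n1_not_prime : ~~ prime_quotient (n - 1) 2)
    (half_n2_not_prime : ~~ prime_quotient (n - 2) 2)
    (alpha beta : {perm 'I_n})
    (alphaA : alpha \in 'Alt_('I_n)) (betaA : beta \in 'Alt_('I_n))
    (p q : nat) (p_prime : prime p) (q_prime : prime q)
    (order_alpha : #[alpha] = p) (order_beta : #[beta] = q) (le_pq : p <= q)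
    (alphas betas : seq {perm 'I_n})
    (alpha_cycles : cycle_factorization alpha alphas)
    (beta_cycles : cycle_factorization beta betas) :
  let exceptional := [/\ size betas = 3,
                         n - #|perm_support beta| < 3
                       & n - #|perm_support alpha| < 3] in
  let d_le := distance_le (proper_power_graph 'Alt_('I_n)) alpha beta in
  (exceptional -> d_le 10) /\ (~ exceptional -> d_le 8).
Proof.
have T51 : 51 < #|'I_n| by rewrite card_ord.
have ca := card_supp_factorization p_prime order_alpha alpha_cycles.
have cb := card_supp_factorization q_prime order_beta beta_cycles.
have la := shiftable_card_supp T51 p_prime ca.
have lb := shiftable_card_supp T51 q_prime cb.
have Ca := cardsC (perm_support alpha); have Cb := cardsC (perm_support beta).
rewrite !card_ord in la lb Ca Cb.
have {}la := la n_not_prime n1_not_prime n2_not_prime half_n_not_prime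
  half_n1_not_prime half_n2_not_prime.
have {}lb := lb n_not_prime n1_not_prime n2_not_prime half_n_not_prime
  half_n1_not_prime half_n2_not_prime.
set exc := [/\ _, _ & _] => /=.
(* Order 3 is treated apart, since such an element is not coprime to its neighbour of order 3; the
   bound 8 then covers both claims. *)
have [p3|p3] := eqVneq p 3.
  have oa3 : #[alpha] = 3 by rewrite order_alpha.
  suff r8 : joined (proper_power_graph 'Alt_('I_n)) 8 alpha beta.
    by split=> _; apply: distance_le_joined => //; apply: joined_leq r8.
  have [q3|q3] := eqVneq q 3; first by apply: reach_3_3; rewrite // order_beta.
  exact: (reach_3 T51 alphaA betaA oa3 q_prime order_beta q3).
have [q3|q3] := eqVneq q 3.
  have ob3 : #[beta] = 3 by rewrite order_beta.
  suff r8 : joined (proper_power_graph 'Alt_('I_n)) 8 alpha beta.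
    by split=> _; apply: distance_le_joined => //; apply: joined_leq r8.
  exact/reach_sym/(reach_3 T51 betaA alphaA ob3 p_prime order_alpha p3).
split=> [_|nexc]; apply: distance_le_joined.
  exact: (reach_ten T51 alphaA betaA p_prime q_prime).
have [sa|] := boolP ((p == 2) || (2 < #|~: perm_support alpha|)).
  exact: (reach_small T51 alphaA betaA p_prime q_prime).
rewrite negb_or -leqNgt => /andP[p2 fa].
have [sb|] := boolP ((q == 2) || (2 < #|~: perm_support beta|)).
  exact/reach_sym/(reach_small T51 betaA alphaA q_prime p_prime).
rewrite negb_or -leqNgt => /andP[q2 fb].
have q0 := prime_gt0 q_prime; have p0 := prime_gt0 p_prime.
(* Both elements now have at most two fixed points, so only the number of cycles of [beta] can fail
   to be exceptional; being at least 3, it is at least 4. *)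
have sb3 : size betas <> 3 by move=> sb3; apply: nexc; split=> //; lia.
have sb2 : 2 < size betas.
  by rewrite -(ltn_pmul2l q0) -cb; move: lb; rewrite (negbTE q2) ltnNge fb.
have q4 : q * 4 <= #|perm_support beta| by rewrite cb leq_pmul2l //; lia.
(* Here [p <= q] enters: [3p <= 3q <= 3n/4 < n - 2], and [alpha] moves at least [n - 2] points. *)
have a3 : p * 3 < #|perm_support alpha| by lia.
exact: (reach_large T51 alphaA betaA p_prime q_prime).
Qed.
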